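(* Let $c>0$ and consider linear costs $c_i=c\,i$, $i\ge1$. Fix $\lambda\in(0,1]$ and $\beta\in(0,1)$. Then for every $i\ge1$ the discounted Whittle index $m_{\beta,(1,i)}$ given in the context is increasing in the transmission success probability $\mu\in(0,1]$. The same holds for the average Whittle index $m_{(1,i)}$ for every $i\ge2$.
   Context: Put $p=\lambda\mu$ and $q=1-p$. For a single-user Age of Information model with packet arrival probability $\lambda$, transmission success probability $\mu$, discount factor $\beta$ and cost $c_i$ per slot at age $i$, the Whittle indices in state $(1,i)$ (packet available, age $i\ge1$) are as follows. Discounted criterion: $m_{\beta,(1,i)}=\mu\Big[\frac{\beta(1-\beta^i)(1-\beta q)}{1-\beta}\,C_{\beta,i+1}(q)-\sum_{j=1}^i\beta^jc_j\Big]$, where $C_{\beta,i}(q)=\sum_{j=1}^\infty(\beta q)^{j-1}c_{i-1+j}$ if $q>0$ and $C_{\beta,i}(0)=c_i$. Average criterion: $m_{(1,i)}=\mu\Big[i\,p\,C_{i+1}(q)-\sum_{j=1}^ic_j\Big]$, where $C_i(q)=\sum_{j=1}^\infty q^{j-1}c_{i-1+j}$ if $q>0$ and $C_i(0)=c_i$. For linear costs these reduce to $m_{\beta,(1,i)}=\frac{\beta c\mu}{1-\beta}\Big[i-\frac{\beta(1-\beta^i)p}{(1-\beta)(1-\beta q)}\Big]$ and $m_{(1,i)}=c\mu i\big(\frac{i-1}2+\frac1p\big)$. *)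

(* Defs.v *)
From Stdlib Require Import Reals.
From Coquelicot Require Import Coquelicot.
Open Scope R_scope.

(* Ages start at 1; the value of a cost function [c : nat -> R] at 0 is never
   used below. *)
Definition linear_cost (c : R) (i : nat) : R := c * INR i.

(* The series over j >= 1 are reindexed by k = j - 1, so that c_{i-1+j} is
   [c (i + k)]. *)
Definition disc_C (beta : R) (c : nat -> R) (i : nat) (q : R) : R :=
  if Rlt_dec 0 q then Series (fun k => (beta * q) ^ k * c (i + k)%nat)
  else c i.

Definition avg_C (c : nat -> R) (i : nat) (q : R) : R :=
  if Rlt_dec 0 q then Series (fun k => q ^ k * c (i + k)%nat)
  else c i.

(* Index of state (1, i): a packet is available and the age is i. *)
Definition disc_whittle (beta lambda : R) (c : nat -> R) (i : nat) (mu : R) : R :=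
  let q := 1 - lambda * mu in
  mu * (beta * (1 - beta ^ i) * (1 - beta * q) / (1 - beta)
          * disc_C beta c (i + 1) q
        - sum_n_m (fun j => beta ^ j * c j) 1 i).

Definition avg_whittle (lambda : R) (c : nat -> R) (i : nat) (mu : R) : R :=
  let p := lambda * mu in
  let q := 1 - p in
  mu * (INR i * p * avg_C c (i + 1) q - sum_n_m c 1 i).

(* Main.v *)
(* The arithmetic-geometric series gives, for linear costs and
   [A = beta + ... + beta^i], [p = lambda mu],
   [m_{beta,(1,i)} = c mu (sum_{j<=i} (i - j) beta^j + A / (1 - beta + beta p))]
   and [m_{(1,i)} = c i (mu (i - 1) / 2 + 1 / lambda)].  The first is a nonnegative
   multiple of [mu] plus a positive multiple of [mu / (1 - beta + beta lambda mu)],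
   which is strictly increasing since [1 - beta > 0]; the second is affine in [mu]
   with slope [c i (i - 1) / 2]. *)
Require Import Defs.
From Stdlib Require Import Reals Lra Lia.
From Coquelicot Require Import Coquelicot.
Open Scope R_scope.

(* The Cauchy square of the geometric series. *)
Lemma is_series_geom_sqr (x : R) :
  0 <= x < 1 -> is_series (fun k => INR (S k) * x ^ k) (/ (1 - x) * / (1 - x)).
Proof.
  intros Hx.
  assert (Habs : Rabs x < 1) by (rewrite Rabs_pos_eq; lra).
  assert (Hex : ex_series (fun k => Rabs (x ^ k))).
  { apply ex_series_ext with (fun k => Rabs x ^ k).
    - intros k. apply RPow_abs.
    - apply ex_series_geom. rewrite Rabs_Rabsolu. exact Habs. }
  apply is_series_ext with (fun n => sum_f_R0 (fun k => x ^ k * x ^ (n - k)) n).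
  (* Each of the [n + 1] terms of the Cauchy product equals [x ^ n]. *)
  - intros n. rewrite (sum_eq _ (fun _ => x ^ n)).
    + rewrite sum_cte. apply Rmult_comm.
    + intros k Hk. rewrite <- pow_add. f_equal. lia.
  - apply (is_series_mult (pow x) (pow x)); try exact Hex;
      apply is_series_geom; exact Habs.
Qed.

(** Splitting the age as [i + (k + 1)] gives [i] times the geometric series plus its Cauchy
    square. *)
Lemma Series_linear_cost_geom (c x : R) (i : nat) : 0 <= x < 1 ->
  Series (fun k => x ^ k * linear_cost c (i + 1 + k))
  = c * (INR i / (1 - x) + / (1 - x) * / (1 - x)).
Proof.
  intros Hx. apply is_series_unique.
  assert (Hg : is_series (pow x) (/ (1 - x))).
  { apply is_series_geom. rewrite Rabs_pos_eq; lra. }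
  pose proof (is_series_scal c _ _
    (is_series_plus _ _ _ _ (is_series_scal (INR i) _ _ Hg)
                            (is_series_geom_sqr x Hx))) as H.
  refine (is_series_ext _ _ _ _ H).
  intros k. unfold linear_cost, scal, plus; simpl; unfold mult; simpl.
  rewrite !plus_INR. change (INR 1) with 1.
  change (match k with O => 1 | S _ => INR k + 1 end) with (INR (S k)).
  rewrite S_INR. ring.
Qed.

(* The closed form also covers [q = 0], where [disc_C] is defined separately. *)
Lemma disc_C_linear (beta c q : R) (i : nat) : 0 < beta < 1 -> 0 <= q < 1 ->
  disc_C beta (linear_cost c) (i + 1) q
  = c * (INR i / (1 - beta * q) + / (1 - beta * q) * / (1 - beta * q)).
Proof.
  intros Hb Hq. unfold disc_C. destruct (Rlt_dec 0 q).
  - apply Series_linear_cost_geom. nra.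
  - replace q with 0 by lra. unfold linear_cost. rewrite plus_INR. simpl. field.
Qed.

Lemma avg_C_linear (c q : R) (i : nat) : 0 <= q < 1 ->
  avg_C (linear_cost c) (i + 1) q
  = c * (INR i / (1 - q) + / (1 - q) * / (1 - q)).
Proof.
  intros Hq. unfold avg_C. destruct (Rlt_dec 0 q).
  - apply Series_linear_cost_geom. lra.
  - replace q with 0 by lra. unfold linear_cost. rewrite plus_INR. simpl. field.
Qed.

Lemma sum_linear_cost (c : R) (i : nat) :
  sum_n_m (linear_cost c) 1 i = c * (INR i * (INR i + 1) / 2).
Proof.
  induction i as [|i IH].
  - rewrite sum_n_m_zero by lia. unfold zero; simpl. field.
  - rewrite sum_n_Sm by lia. rewrite IH. unfold plus, linear_cost; simpl plus.
    rewrite S_INR. simpl. field.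
Qed.

Lemma geom_weight_pos (beta : R) (i : nat) : 0 < beta < 1 -> (1 <= i)%nat ->
  0 < beta * (1 - beta ^ i) / (1 - beta).
Proof.
  intros Hb Hi.
  assert (beta ^ i < 1) by (apply pow_lt_1_compat; [lra | lia]).
  apply Rdiv_lt_0_compat; nra.
Qed.

(** Each factor [j] is at most [i]; this makes the coefficient of [mu] in the discounted index
    nonnegative. *)
Lemma disc_sum_linear_cost_le (beta c : R) (i : nat) : 0 < beta < 1 -> 0 < c ->
  sum_n_m (fun j => beta ^ j * linear_cost c j) 1 i
  <= c * (INR i * (beta * (1 - beta ^ i) / (1 - beta))).
Proof.
  intros Hb Hc. induction i as [|i IH].
  - rewrite sum_n_m_zero by lia. unfold zero; simpl. lra.
  - rewrite sum_n_Sm by lia.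
    change (plus ?a ?b) with (a + b). unfold linear_cost at 2.
    (* From [i] to [S i] the gap between the two sides grows by exactly [c] times this quantity. *)
    assert (HA : 0 <= beta * (1 - beta ^ i) / (1 - beta)).
    { destruct i as [|i].
      - simpl. right. field. lra.
      - apply Rlt_le, geom_weight_pos; [exact Hb | lia]. }
    replace (beta * (1 - beta ^ S i) / (1 - beta))
      with (beta * (1 - beta ^ i) / (1 - beta) + beta ^ S i) by (simpl; field; lra).
    rewrite S_INR. nra.
Qed.

(** The factor [1 - beta * q], equal to [1 - beta + beta * lambda * mu], cancels one power of each
    denominator in the closed form of [disc_C]. *)
Lemma disc_whittle_linear (beta lambda c mu : R) (i : nat) :
  0 < beta < 1 -> 0 < lambda * mu <= 1 ->
  let A := beta * (1 - beta ^ i) / (1 - beta) in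
  disc_whittle beta lambda (linear_cost c) i mu
  = mu * (c * (INR i * A) - sum_n_m (fun j => beta ^ j * linear_cost c j) 1 i)
    + c * A * (mu / (1 - beta + beta * lambda * mu)).
Proof.
  intros Hb Hp A. unfold disc_whittle, A. rewrite disc_C_linear by lra.
  field. nra.
Qed.

Lemma avg_whittle_linear (lambda c mu : R) (i : nat) :
  0 < lambda -> 0 < mu -> lambda * mu <= 1 ->
  avg_whittle lambda (linear_cost c) i mu
  = c * INR i * (mu * (INR i - 1) / 2 + / lambda).
Proof.
  intros Hl Hm Hp. unfold avg_whittle.
  rewrite avg_C_linear by nra. rewrite sum_linear_cost.
  field. nra.
Qed.

(** After cross-multiplication the terms [b * x * y] cancel, leaving [a * (y - x)]. *)
Lemma div_affine_lt (a b x y : R) : 0 < a -> 0 <= b -> 0 < x -> x < y ->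
  x / (a + b * x) < y / (a + b * y).
Proof.
  intros Ha Hb Hx Hxy.
  apply Rminus_gt_0_lt.
  replace (y / (a + b * y) - x / (a + b * x))
    with (a * (y - x) / ((a + b * x) * (a + b * y))) by (field; nra).
  apply Rdiv_lt_0_compat; [nra | apply Rmult_lt_0_compat; nra].
Qed.

Theorem proposition6 (c lambda beta : R)
    (hc : 0 < c) (hlambda : 0 < lambda <= 1) (hbeta : 0 < beta < 1) :
  (forall i : nat, (1 <= i)%nat ->
     forall mu1 mu2 : R, 0 < mu1 -> mu1 < mu2 -> mu2 <= 1 ->
       disc_whittle beta lambda (linear_cost c) i mu1
       < disc_whittle beta lambda (linear_cost c) i mu2) /\
  (forall i : nat, (2 <= i)%nat ->
     forall mu1 mu2 : R, 0 < mu1 -> mu1 < mu2 -> mu2 <= 1 ->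
       avg_whittle lambda (linear_cost c) i mu1
       < avg_whittle lambda (linear_cost c) i mu2).
Proof.
  split; intros i Hi mu1 mu2 H1 H12 H2.
  - rewrite !disc_whittle_linear by nra.
    (* Strictness comes from the second summand; the coefficient of [mu] in the first vanishes at
       [i = 1]. *)
    apply Rplus_le_lt_compat.
    + apply Rmult_le_compat_r; [|lra].
      pose proof (disc_sum_linear_cost_le beta c i hbeta hc). lra.
    + apply Rmult_lt_compat_l.
      * apply Rmult_lt_0_compat; [exact hc | apply geom_weight_pos; assumption].
      * apply div_affine_lt; nra.
  - rewrite !avg_whittle_linear by nra.
    (* This makes the slope strictly positive; at [i = 1] the average index is the constant
       [c / lambda]. *)
    assert (Hn : 2 <= INR i) by (apply (le_INR 2); exact Hi).
    apply Rmult_lt_compat_l; nra.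
Qed.
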